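(* Let $\Pi=(X,U,F,G,g)$ be an optimal control problem, let $V\colon X\to[0,\infty]$ be its value function, and let $P$ be its dynamic programming operator. Then $V$ is the maximal fixed point of $P$, i.e., $P(V)=V$, and for every $W\colon X\to[0,\infty]$, $W\le P(W)$ implies $W\le V$. Moreover, for all $p\in X$, $$V(p)=\sup_{\beta\in\Delta(p)}\ \inf_{u\in U^{\mathbb{Z}_+}}\ \inf_{v\in\{0,1\}^{\mathbb{Z}_+}} J(u,v,\beta(u)),$$ where $J$ is the cost functional of $\Pi$ and $\Delta(p)$ is the set of all strictly causal maps $\beta\colon U^{\mathbb{Z}_+}\to X^{\mathbb{Z}_+}$ such that, for every $u\in U^{\mathbb{Z}_+}$, $(u,\beta(u))$ is a solution of the system $(X,U,F)$ with $\beta(u)(0)=p$.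
   Context: Conventions: $\mathbb{R}_+=[0,\infty)$, $\mathbb{Z}_+=\{0,1,2,\dots\}$; $\infty+x=\infty$ for $x\in\mathbb{R}$; $\sup\emptyset=0$; $A^B$ is the set of maps $B\to A$; inequalities between functions are pointwise. A set-valued map $f\colon A\rightrightarrows B$ assigns to each $a\in A$ a subset $f(a)\subseteq B$; it is strict if $f(a)\neq\emptyset$ for all $a$. System: a triple $(X,U,F)$ with nonempty sets $X,U$ and strict $F\colon X\times U\rightrightarrows X$. A pair $(u,x)\in U^{\mathbb{Z}_+}\times X^{\mathbb{Z}_+}$ is a solution of it if $x(t+1)\in F(x(t),u(t))$ for all $t\in\mathbb{Z}_+$. Controller for $(X,U,F)$: a quintuple $C=(Z,Z_0,\widetilde X,\widetilde U,H)$ of nonempty sets $Z,Z_0,\widetilde X,\widetilde U$ with $Z_0\subseteq Z$, $X\subseteq\widetilde X$, $\widetilde U\subseteq U$, and a strict map $H\colon Z\times\widetilde X\rightrightarrows Z\times\widetilde U\times\{0,1\}$. A quadruple $(u,v,z,x)\in\widetilde U^{\mathbb{Z}_+}\times\{0,1\}^{\mathbb{Z}_+}\times Z^{\mathbb{Z}_+}\times\widetilde X^{\mathbb{Z}_+}$ is a solution of $C$ if $z(0)\in Z_0$ and $(z(t+1),u(t),v(t))\in H(z(t),x(t))$ for all $t\in\mathbb{Z}_+$. $\mathcal{F}(X,U)$ denotes the collection of all controllers for $(X,U,F)$. Behavior: for a system $S=(X,U,F)$ and $C\in\mathcal{F}(X,U)$, $\mathcal{B}(C\times S)$ is the set of $(u,v,x)\in(U\times\{0,1\}\times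 X)^{\mathbb{Z}_+}$ for which there is $z\colon\mathbb{Z}_+\to Z$ such that $(u,v,z,x)$ is a solution of $C$ and $(u,x)$ is a solution of $S$; $\mathcal{B}_p(C\times S)=\{(u,v,x)\in\mathcal{B}(C\times S): x(0)=p\}$. Optimal control problem: a tuple $(X,U,F,G,g)$ where $(X,U,F)$ is a system, $G\colon X\to\mathbb{R}_+\cup\{\infty\}$ (terminal cost) and $g\colon X\times X\times U\to\mathbb{R}_+\cup\{\infty\}$ (running cost). Its cost functional $J\colon(U\times\{0,1\}\times X)^{\mathbb{Z}_+}\to[0,\infty]$ is $J(u,v,x)=G(x(T))+\sum_{t=0}^{T-1}g(x(t),x(t+1),u(t))$ if $v\neq0$, where $T=\min v^{-1}(1)$, and $J(u,v,x)=\infty$ if $v=0$. With $S=(X,U,F)$, its value function is $V(p)=\inf_{C\in\mathcal{F}(X,U)}\sup_{(u,v,x)\in\mathcal{B}_p(C\times S)}J(u,v,x)$. Dynamic programming operator: for $W\colon X\to[0,\infty]$, $P(W)\colon X\to[0,\infty]$ is $P(W)(p)=\min\{G(p),\ \inf_{u\in U}\sup_{q\in F(p,u)}(g(p,q,u)+W(q))\}$. Strict causality: $\beta\colon U^{\mathbb{Z}_+}\to X^{\mathbb{Z}_+}$ is strictly causal if for all $u,\tilde u\in U^{\mathbb{Z}_+}$ and $T\in\mathbb{Z}_+$, $u(t)=\tilde u(t)$ for all integers $0\le t<T$ implies $\beta(u)(t)=\beta(\tilde u)(t)$ for all integers $0\le t\le T$. *)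

(* Defs.v *)
From HB Require Import structures.
From mathcomp Require Import all_boot all_order all_algebra.
From mathcomp Require Import all_classical all_reals ereal.

Set Implicit Arguments.
Unset Strict Implicit.
Unset Printing Implicit Defensive.

Import Order.TTheory GRing.Theory Num.Theory.

Local Open Scope classical_set_scope.
Local Open Scope ring_scope.

(* A set-valued map f : A => B is a function A -> set B. *)
Definition strict_map (A B : Type) (f : A -> set B) : Prop :=
  forall a, f a !=set0.

Record system (X U : Type) := System {
  state_nonempty : inhabited X;
  input_nonempty : inhabited U;
  transition : X * U -> set X;
  transition_strict : strict_map transition }.

Definition system_solution (X U : Type) (S : system X U)
    (u : nat -> U) (x : nat -> X) : Prop :=
  forall t, transition S (x t, u t) (x t.+1).

(* The inclusion of X in the controller's input alphabet is an injection
   [ctrl_incl], since that alphabet may be any set containing X; the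
   controller's output alphabet [ctrl_out] is a subset of U, and [ctrl_map_out]
   says that [ctrl_map] takes values in subsets of Z * ctrl_out * {0,1}. *)
Record controller (X U : Type) := Controller {
  ctrl_state : Type;
  ctrl_init : set ctrl_state;
  ctrl_in : Type;
  ctrl_incl : X -> ctrl_in;
  ctrl_out : set U;
  ctrl_map : ctrl_state * ctrl_in -> set (ctrl_state * U * bool);
  ctrl_state_nonempty : inhabited ctrl_state;
  ctrl_init_nonempty : ctrl_init !=set0;
  ctrl_in_nonempty : inhabited ctrl_in;
  ctrl_out_nonempty : ctrl_out !=set0;
  ctrl_incl_inj : injective ctrl_incl;
  ctrl_map_out : forall a z u b, ctrl_map a (z, u, b) -> ctrl_out u;
  ctrl_map_strict : strict_map ctrl_map }.

Arguments ctrl_init {X U} _ _.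
Arguments ctrl_incl {X U} _ _.
Arguments ctrl_map {X U} _ _ _.

Definition controller_solution (X U : Type) (C : controller X U)
    (u : nat -> U) (v : nat -> bool) (z : nat -> ctrl_state C)
    (x : nat -> ctrl_in C) : Prop :=
  [/\ forall t, ctrl_out C (u t),
      ctrl_init C (z 0%N) &
      forall t, ctrl_map C (z t, x t) (z t.+1, u t, v t)].

Arguments controller_solution {X U} C u v z x.

(* (U * {0,1} * X)^{Z_+}, as triples of signals *)
Definition signals (X U : Type) : Type :=
  ((nat -> U) * (nat -> bool) * (nat -> X))%type.

Definition behavior (X U : Type) (C : controller X U) (S : system X U) :
    set (signals X U) :=
  [set w | let: (u, v, x) := w in
    (exists z : nat -> ctrl_state C,
      controller_solution C u v z (fun t => ctrl_incl C (x t))) /\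
    system_solution S u x].

Definition behavior_from (X U : Type) (C : controller X U) (S : system X U)
    (p : X) : set (signals X U) :=
  [set w | behavior C S w /\ w.2 0%N = p].

Local Open Scope ereal_scope.

(* Supremum in [0, +oo], so that the supremum of set0 is 0 and not -oo. *)
Definition nnsup (R : realType) (A : set (\bar R)) : \bar R :=
  ereal_sup (0 |` A).

Record control_problem (R : realType) (X U : Type) := ControlProblem {
  plant : system X U;
  terminal_cost : X -> \bar R;
  running_cost : X -> X -> U -> \bar R;
  terminal_cost_ge0 : forall p, 0 <= terminal_cost p;
  running_cost_ge0 : forall p q u, 0 <= running_cost p q u }.

Section ControlProblem.
Context (R : realType) (X U : Type) (Pi : control_problem R X U).

Definition cost (w : signals X U) : \bar R :=
  let: (u, v, x) := w in
  if pselect (exists t, v t) is left v_neq0 then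
    let T := ex_minn v_neq0 in
    terminal_cost Pi (x T) +
      \sum_(0 <= t < T) running_cost Pi (x t) (x t.+1) (u t)
  else +oo.

(* The index is bound by [exists] rather than [range]: [range] would force the
   universe of controller states to be strictly below that of [set], so that
   types of sets could not be used as state spaces. *)
Definition value (p : X) : \bar R :=
  ereal_inf [set c | exists C : controller X U,
    c = nnsup [set cost w | w in behavior_from C (plant Pi) p]].

Definition dp_operator (W : X -> \bar R) (p : X) : \bar R :=
  Order.min (terminal_cost Pi p)
    (ereal_inf (range (fun u : U =>
      nnsup [set running_cost Pi p q u + W q
            | q in transition (plant Pi) (p, u)]))).

End ControlProblem.

Definition strictly_causal (X U : Type) (beta : (nat -> U) -> (nat -> X)) :
    Prop :=
  forall (u u' : nat -> U) (T : nat),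
    (forall t, (t < T)%N -> u t = u' t) ->
    forall t, (t <= T)%N -> beta u t = beta u' t.

Definition causal_responses (X U : Type) (S : system X U) (p : X) :
    set ((nat -> U) -> (nat -> X)) :=
  [set beta | strictly_causal beta /\
    forall u, system_solution S u (beta u) /\ beta u 0%N = p].

(* Main.v *)
Require Import Defs.
From mathcomp Require Import all_boot all_order all_algebra.
From mathcomp Require Import all_classical all_reals ereal.

Local Open Scope classical_set_scope.
Local Open Scope ereal_scope.

Import Order.TTheory GRing.Theory Num.Theory.

(** Write [V] for the value function, [P] for the dynamic programming operator
    and [D] for the sup-inf over strictly causal responses ([causal_value]).
    Three inequalities carry everything.

    - [D <= V]: a controller and a strictly causal response can always be run
      against each other.  The state [beta u t] depends only on the inputs
      before [t], so the loop can be solved step by step, and the resulting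
      trajectory bounds the inner infimum of [D] from above and the worst case
      of the controller from below ([causal_value_le_value]).

    - [W <= P W] implies [W <= D]: if [c < W p], the adversary can answer every
      input by a successor that keeps [c] strictly below the cost accumulated so
      far plus [W] at the current state.  Since [W] is below the terminal cost,
      stopping never costs less than [c]
      ([subsolution_le_causal_value]).

    - [V <= P V]: a controller may stop at once, or apply a fixed input [a],
      observe the successor [q] and from then on run a nearly optimal controller
      for [q] ([value_le_dp_operator]).

    The first two say that [V] dominates every [W] with [W <= P W].  By the
    third, [V] is itself such a [W], whence [V <= D] and so [V = D].  Finally
    [P] is monotone, so [V <= P V] gives [P V <= P (P V)]; thus [P V] is another
    such [W], and [P V <= V].

    Suprema and infima need not be attained.  In the second inequality a strict
    inequality is propagated along the trajectory, so that no errors accumulate;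
    in the third, one error [e > 0] is enough because the controller selected at
    [q] is kept from then on. *)

(** * Dependent choice and suprema of nonnegative values *)

(** The invariant [P] may depend on time, which lets a sequence be built inside
    one summand of a type of states without transporting along equalities. *)
Lemma indexed_dependent_choice (A : Type) (P : nat -> A -> Prop)
    (Q : nat -> A -> A -> Prop) (a0 : A) :
  P 0%N a0 ->
  (forall t a, P t a -> exists b, P t.+1 b /\ Q t a b) ->
  exists s : nat -> A,
    s 0%N = a0 /\ forall t, P t (s t) /\ Q t (s t) (s t.+1).
Proof.
move=> P0 step.
have ex (ta : nat * A) :
    exists b, P ta.1 ta.2 -> P ta.1.+1 b /\ Q ta.1 ta.2 b.
  case: (pselect (P ta.1 ta.2)) => [/step[b Hb]|nP]; first by exists b.
  by exists a0.
have [f Hf] := choice ex.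
pose s := nat_rect (fun=> A) a0 (fun t a => f (t, a)).
have Ps t : P t (s t) by elim: t => [//|t /(Hf (t, s t))[]].
by exists s; split=> // t; have [] := Hf (t, s t) (Ps t).
Qed.

Lemma nnsup_ge0 (R : realType) (A : set (\bar R)) : 0 <= nnsup A.
Proof. by apply: ereal_sup_ubound; left. Qed.

Lemma nnsup_ubound (R : realType) (A : set (\bar R)) a : A a -> a <= nnsup A.
Proof. by move=> Aa; apply: ereal_sup_ubound; right. Qed.

Lemma ge_nnsup (R : realType) (A : set (\bar R)) b :
  0 <= b -> (forall a, A a -> a <= b) -> nnsup A <= b.
Proof. by move=> b0 Ab; apply: ge_ereal_sup => a [->|/Ab]. Qed.

(** * The cost functional *)

Section Cost.
Context {R : realType} {X U : Type} (Pi : control_problem R X U).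

Lemma cost_stop (u : nat -> U) (v : nat -> bool) (x : nat -> X) T :
  v T -> (forall t, (t < T)%N -> ~~ v t) ->
  cost Pi (u, v, x) = terminal_cost Pi (x T) +
    \sum_(0 <= t < T) running_cost Pi (x t) (x t.+1) (u t).
Proof.
move=> vT vlt; rewrite /cost; case: pselect => [ex|nex]; last first.
  by case: nex; exists T.
case: ex_minnP => T' vT' minT'.
suff -> : T' = T by [].
apply/eqP; rewrite eqn_leq minT' //= leqNgt.
by apply/negP => /vlt; rewrite vT'.
Qed.

Lemma cost_never (u : nat -> U) (v : nat -> bool) (x : nat -> X) :
  (forall t, ~~ v t) -> cost Pi (u, v, x) = +oo.
Proof.
move=> nv; rewrite /cost; case: pselect => [[t vt]|//].
by have := nv t; rewrite vt.
Qed.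

Variant stopping_spec (v : nat -> bool) : Prop :=
  | Stops T of v T & (forall t, (t < T)%N -> ~~ v t)
  | NeverStops of (forall t, ~~ v t).

Lemma stoppingP v : stopping_spec v.
Proof.
case: (pselect (exists t, v t)) => [ex|nex].
  case: (ex_minnP ex) => T vT minT; apply: (Stops _ T) => // t tT.
  by apply/negP => /minT; rewrite leqNgt tT.
by apply: NeverStops => t; apply/negP => vt; apply: nex; exists t.
Qed.

(** Running costs are nonnegative, so the identity also holds when both sides
    are infinite because the trajectory never stops. *)
Lemma cost_shift (u : nat -> U) (v : nat -> bool) (x : nat -> X) :
  ~~ v 0%N ->
  cost Pi (u, v, x) = running_cost Pi (x 0%N) (x 1%N) (u 0%N) +
    cost Pi (fun t => u t.+1, fun t => v t.+1, fun t => x t.+1).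
Proof.
move=> v0; case: (stoppingP (fun t => v t.+1)) => [T vT vlt|nv].
  rewrite (cost_stop u v x T.+1) // ?(cost_stop _ _ _ T) //; last first.
    by move=> [|t] //; exact: vlt.
  by rewrite big_nat_recl // addeCA.
rewrite !cost_never //; last by move=> [|t].
by rewrite addey // gt_eqF // (lt_le_trans (ltNye_eq 0)) // running_cost_ge0.
Qed.

End Cost.

(** * Running a controller against a strictly causal response *)

Section ClosedLoop.
Context {X U : Type} (S : system X U).

(** The input is built one value at a time.  At time [t] the part before [t] is
    settled, and by strict causality it determines the state [beta u t]; the
    controller then supplies [u t]. *)
Lemma closed_loop_response (C : controller X U) (p : X)
    (beta : (nat -> U) -> (nat -> X)) :
  causal_responses S p beta ->
  exists u v, behavior_from C S p (u, v, beta u).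
Proof.
move=> [causal resp].
have [u0] := input_nonempty S.
have [z0 Zz0] := ctrl_init_nonempty C.
(* A state at time t is a full input signal, reliable only before t and padded
   arbitrarily after, together with a controller state. *)
pose H t (a b : (nat -> U) * ctrl_state C) :=
  (forall s, (s < t)%N -> b.1 s = a.1 s) /\
  exists o, ctrl_map C (a.2, ctrl_incl C (beta a.1 t)) (b.2, b.1 t, o).
have step t a : True -> exists b, True /\ H t a b.
  move=> _; have [[[z' u'] o] Hz] :=
    @ctrl_map_strict _ _ C (a.2, ctrl_incl C (beta a.1 t)).
  exists (fun s => if (s < t)%N then a.1 s else u', z'); split=> //.
  by split=> [s /= ->//|]; exists o; rewrite /= ltnn.
have [s [s0 Hs]] := indexed_dependent_choice _ (fun _ _ => True) H
  (fun=> u0, z0) I step.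
(* The diagonal of the approximating inputs: the value at t is settled in the
   approximation at time t.+1 and never changed later. *)
pose u t := (s t.+1).1 t.
have uE t r : (r < t)%N -> (s t).1 r = u r.
  elim: t => // t IH; rewrite ltnS leq_eqVlt => /orP[/eqP->//|rt].
  by have [_ [sE _]] := Hs t; rewrite sE //; exact: IH.
have xE t : beta (s t).1 t = beta u t.
  by apply: (causal _ _ t) => // r; exact: uE.
have exv t : exists o,
    ctrl_map C ((s t).2, ctrl_incl C (beta u t)) ((s t.+1).2, u t, o).
  by have [_ [_ [o]]] := Hs t; rewrite xE; exists o.
have [v Hv] := choice exv.
have [sol xp] := resp u.
exists u, v; split=> //; split=> //.
exists (fun t => (s t).2); split=> //.
- by move=> t; exact: ctrl_map_out (Hv t).
- by rewrite s0.
Qed.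

End ClosedLoop.

(** * Stopping at once, and switching controllers after one step *)

Section Controllers.
Context {X U : Type} (x0 : X) (u0 : U).

Definition stop_controller : controller X U :=
  {| ctrl_state := unit; ctrl_init := setT; ctrl_in := X; ctrl_incl := id;
     ctrl_out := setT; ctrl_map := fun=> [set (tt, u0, true)];
     ctrl_state_nonempty := inhabits tt;
     ctrl_init_nonempty := ex_intro _ tt I;
     ctrl_in_nonempty := inhabits x0;
     ctrl_out_nonempty := ex_intro _ u0 I;
     ctrl_incl_inj := @inj_id X;
     ctrl_map_out := fun _ _ _ _ _ => I;
     ctrl_map_strict := fun=> ex_intro _ (tt, u0, true) erefl |}.

Context (C : X -> controller X U).

(** States of a controller that applies [u0] once, then reads the state [q]
    reached and behaves like [C q] forever. *)
Inductive delayed_state : Type :=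
  | Waiting
  | Selecting
  | Running (q : X) of ctrl_state (C q).

Definition run_from (q x : X) (z : ctrl_state (C q)) :
    set (delayed_state * U * bool) :=
  [set w | exists2 a, ctrl_map (C q) (z, ctrl_incl (C q) x) a &
                      w = (Running q a.1.1, a.1.2, a.2)].

(** In [Selecting] the observed state serves twice: it chooses the controller
    and is also the first measurement fed to it, so that the chosen controller
    starts from one of its own initial states without losing a time step. *)
Definition delayed_map (a : delayed_state * X) :
    set (delayed_state * U * bool) :=
  match a.1 with
  | Waiting => [set (Selecting, u0, false)]
  | Selecting => \bigcup_(z in ctrl_init (C a.2)) run_from a.2 a.2 z
  | Running q z => run_from q a.2 z
  end.

Lemma delayed_map_strict : strict_map delayed_map.
Proof.
move=> [[||q z] x]; rewrite /delayed_map /=.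
- by exists (Selecting, u0, false).
- have [z Zz] := ctrl_init_nonempty (C x).
  have [a Ha] := @ctrl_map_strict _ _ (C x) (z, ctrl_incl (C x) x).
  by exists (Running x a.1.1, a.1.2, a.2), z => //; exists a.
- have [a Ha] := @ctrl_map_strict _ _ (C q) (z, ctrl_incl (C q) x).
  by exists (Running q a.1.1, a.1.2, a.2), a.
Qed.

Definition delayed_controller : controller X U :=
  {| ctrl_state := delayed_state; ctrl_init := [set Waiting]; ctrl_in := X;
     ctrl_incl := id; ctrl_out := setT; ctrl_map := delayed_map;
     ctrl_state_nonempty := inhabits Waiting;
     ctrl_init_nonempty := ex_intro _ Waiting erefl;
     ctrl_in_nonempty := inhabits x0;
     ctrl_out_nonempty := ex_intro _ u0 I;
     ctrl_incl_inj := @inj_id X;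
     ctrl_map_out := fun _ _ _ _ _ => I;
     ctrl_map_strict := delayed_map_strict |}.

Lemma stop_behavior (S : system X U) (p : X) u v x :
  behavior_from stop_controller S p (u, v, x) -> v 0%N /\ x 0%N = p.
Proof. by move=> [[[z [_ _ /(_ 0%N)[_ _ ->]]] _] /= xp]. Qed.

(** After its first step a trajectory of the delayed controller is a trajectory
    of the controller selected at the state reached. *)
Lemma delayed_behavior (S : system X U) (p : X) u v x :
  behavior_from delayed_controller S p (u, v, x) ->
  [/\ u 0%N = u0, ~~ v 0%N, x 0%N = p, transition S (p, u0) (x 1%N) &
      behavior_from (C (x 1%N)) S (x 1%N)
        (fun t => u t.+1, fun t => v t.+1, fun t => x t.+1)].
Proof.
move=> [[[z [_ z0 Hz]] sol] /= xp].
have := Hz 0%N; rewrite /= /delayed_map z0 /= => -[z1 u0E v0E].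
have := Hz 1%N; rewrite /= /delayed_map z1 /= => -[zc0 Zzc0].
set q := x 1%N in zc0 Zzc0 *.
move=> [[[zc1 u1] v1] /= Hc0 [z2 u1E v1E]].
(* The selected controller starts at time 1 in zc0, and its states from time 2
   on are the contents of the Running states. *)
pose P t zc := z t.+2 = Running q zc.
pose Q t zc zc' := ctrl_map (C q) (zc, ctrl_incl (C q) (x t.+2))
  (zc', u t.+2, v t.+2).
have step t zc : P t zc -> exists zc', P t.+1 zc' /\ Q t zc zc'.
  move=> Pt; have := Hz t.+2; rewrite /= /delayed_map Pt /=.
  move=> [[[zc' u'] v'] /= Hc [zE uE vE]].
  by exists zc'; split; rewrite /P /Q ?uE ?vE.
have [s [s0 Hs]] := indexed_dependent_choice _ P Q zc1 z2 step.
have Hall t : ctrl_map (C q)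
    ((if t is t'.+1 then s t' else zc0), ctrl_incl (C q) (x t.+1))
    (s t, u t.+1, v t.+1).
  by case: t => [|t]; [rewrite s0 u1E v1E|have [] := Hs t].
split=> //; first by rewrite v0E.
  by rewrite -xp -u0E; exact: sol.
split=> //; split; last by move=> t; exact: sol.
exists (fun t => if t is t'.+1 then s t' else zc0); split=> // t.
exact: ctrl_map_out (Hall t).
Qed.

End Controllers.

(** * Dynamic programming *)

Section DynamicProgramming.
Context {R : realType} {X U : Type} (Pi : control_problem R X U).

Let S := plant Pi.

Definition causal_value (p : X) : \bar R :=
  nnsup (image (causal_responses S p)
    (fun beta : (nat -> U) -> (nat -> X) =>
    ereal_inf (range (fun u : nat -> U =>
      ereal_inf (range (fun v : nat -> bool =>
        cost Pi (u, v, beta u))))))).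

Lemma value_ge0 p : 0 <= value Pi p.
Proof. by apply: le_ereal_inf_tmp => _ [C ->]; exact: nnsup_ge0. Qed.

Lemma causal_value_le_value p : causal_value p <= value Pi p.
Proof.
apply: le_ereal_inf_tmp => _ [C ->].
apply: ge_nnsup => [|_ [beta Dbeta <-]]; first exact: nnsup_ge0.
have [u [v uvP]] := closed_loop_response S C p beta Dbeta.
apply: le_trans (_ : cost Pi (u, v, beta u) <= _); last first.
  by apply: nnsup_ubound; exists (u, v, beta u).
apply: le_trans (ereal_inf_lbound _) _; first by exists u.
by apply: ereal_inf_lbound; exists v.
Qed.

Lemma dp_operator_homo (W W' : X -> \bar R) :
  (forall p, W p <= W' p) ->
  forall p, dp_operator Pi W p <= dp_operator Pi W' p.
Proof.
move=> WW' p; rewrite /dp_operator le_min ge_min lexx /= ge_min.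
apply/orP; right; apply: le_ereal_inf_tmp => _ [a _ <-].
apply: le_trans (ereal_inf_lbound _) _; first by exists a.
apply: ge_nnsup => [|_ [q Fq <-]]; first exact: nnsup_ge0.
apply: le_trans (leeD2l _ (WW' q)) _.
by apply: nnsup_ubound; exists q.
Qed.

Lemma dp_operator_ge0 W p : 0 <= dp_operator Pi W p.
Proof.
rewrite /dp_operator le_min terminal_cost_ge0 /=.
by apply: le_ereal_inf_tmp => _ [a _ <-]; exact: nnsup_ge0.
Qed.

(** If every successor failed, then [c - b] would bound every
    [g + W q], hence the supremum over successors, hence [W x].
    Keeping the accumulated cost [b] on the right-hand side, rather than
    subtracting it from [c], is what covers infinite running costs. *)
Lemma adversarial_successor (W : X -> \bar R) (x : X) (a : U) (b c : \bar R) :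
  (forall p, 0 <= W p) ->
  W x <= dp_operator Pi W x ->
  0 <= b -> c < b + W x ->
  exists2 q, transition S (x, a) q &
    c < b + running_cost Pi x q a + W q.
Proof.
move=> W0 WP b0 cW.
have [q0 Fq0] := @transition_strict _ _ S (x, a).
apply: contrapT => /forall2NP noq.
have le q : transition S (x, a) q -> b + running_cost Pi x q a + W q <= c.
  by move=> Fq; rewrite leNgt; apply/negP => ?; case: (noq q).
have bc : b <= c.
  apply: le_trans (le _ Fq0); rewrite -addeA leeDl //.
  by rewrite adde_ge0 // running_cost_ge0.
have coo : c != +oo by rewrite -ltey (lt_le_trans cW) // leey.
have bfin : b \is a fin_num.
  by rewrite ge0_fin_numE // (le_lt_trans bc) // ltey.
move: cW; apply/negP; rewrite -leNgt.
apply: le_trans (_ : b + (c - b) <= _); last by rewrite addeC subeK.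
apply: leeD2l; apply: (le_trans WP); rewrite /dp_operator ge_min.
apply/orP; right; apply: le_trans (ereal_inf_lbound _) _; first by exists a.
apply: ge_nnsup => [|_ [q Fq <-]]; first by rewrite sube_ge0 // bfin.
by rewrite leeBrDl // addeA le.
Qed.

(** The response remembers its current state and the cost accumulated so far,
    and moves by [adversarial_successor].  At a stopping time, [W] is below the
    terminal cost, so the accumulated cost plus the terminal cost exceeds
    [c]. *)
Lemma adversarial_response (W : X -> \bar R) (p : X) (c : \bar R) :
  (forall p, 0 <= W p) ->
  (forall p, W p <= dp_operator Pi W p) ->
  c < W p ->
  exists2 beta, causal_responses S p beta &
    forall u v, c <= cost Pi (u, v, beta u).
Proof.
move=> W0 WP cW.
have ex (w : X * \bar R * U) : exists q,
    transition S (w.1.1, w.2) q /\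
    (0 <= w.1.2 -> c < w.1.2 + W w.1.1 ->
     c < w.1.2 + running_cost Pi w.1.1 q w.2 + W q).
  case: w => -[x b] a /=.
  case: (pselect (0 <= b /\ c < b + W x)) => [[b0 cb]|nb].
    have [q ? ?] := adversarial_successor W x a b c W0 (WP x) b0 cb.
    by exists q.
  have [q Fq] := @transition_strict _ _ S (x, a).
  by exists q; split=> // b0 cb; case: nb.
have [next Hnext] := choice ex.
(* The pair of the current state and the accumulated cost at time t depends only
   on the inputs before t, which is strict causality. *)
pose st u := nat_rect (fun=> (X * \bar R)%type) (p, 0) (fun t w =>
  let q := next (w, u t) in (q, w.2 + running_cost Pi w.1 q (u t))).
have stS u t : st u t.+1 = (next (st u t, u t), (st u t).2 +
    running_cost Pi (st u t).1 (next (st u t, u t)) (u t)) by [].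
pose beta u t := (st u t).1.
have stE u t : (st u t).2 =
    \sum_(0 <= s < t) running_cost Pi (beta u s) (beta u s.+1) (u s).
  elim: t => [|t IH]; first by rewrite big_nil.
  by rewrite big_nat_recr //= -IH.
have st0 u t : 0 <= (st u t).2.
  by rewrite stE; apply: sume_ge0 => s _; exact: running_cost_ge0.
have inv u t : c < (st u t).2 + W (beta u t).
  elim: t => [|t IH]; first by rewrite add0e.
  exact: (Hnext (st u t, u t)).2 (st0 u t) IH.
exists beta.
  split=> [u u' T uu' t tT|u].
    suff E : st u t = st u' t by rewrite /beta E.
    elim: t tT => // t IH tT.
    by rewrite !stS IH ?(ltnW tT) // uu'.
  by split=> // t; exact: (Hnext (st u t, u t)).1.
move=> u v; case: (stoppingP v) => [T vT vlt|nv].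
  rewrite (cost_stop _ _ _ _ T) // -stE addeC.
  apply: le_trans (ltW (inv u T)) (leeD2l _ _).
  by apply: le_trans (WP _) _; rewrite /dp_operator ge_min lexx.
by rewrite cost_never // leey.
Qed.

(** Otherwise some [c = D p + e] lies below [W p], and an adversarial response
    for [c] witnesses [D p >= c]. *)
Lemma subsolution_le_causal_value (W : X -> \bar R) :
  (forall p, 0 <= W p) ->
  (forall p, W p <= dp_operator Pi W p) ->
  forall p, W p <= causal_value p.
Proof.
move=> W0 WP p; apply/lee_addgt0Pr => e e0.
rewrite leNgt; apply/negP => lt.
have [beta Dbeta cbeta] := adversarial_response W p _ W0 WP lt.
have le : causal_value p + e%:E <= causal_value p.
  apply: le_trans (nnsup_ubound _ _ _ _); last by exists beta.
  apply: le_ereal_inf_tmp => _ [u _ <-].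
  by apply: le_ereal_inf_tmp => _ [v _ <-].
have fin : causal_value p \is a fin_num.
  rewrite ge0_fin_numE; last exact: nnsup_ge0.
  apply: le_lt_trans (lt_le_trans lt (leey _)).
  by rewrite leeDl // lee_fin ltW.
by move: le; rewrite leNgt lteDl // lte_fin e0.
Qed.

(** Where the value is infinite any controller will do, and one exists. *)
Lemma near_optimal_controller (p : X) (e : R) : (0 < e)%R ->
  exists C : controller X U,
    nnsup [set cost Pi w | w in behavior_from C S p] <= value Pi p + e%:E.
Proof.
move=> e0; have [fin|] := boolP (value Pi p \is a fin_num).
  by have [_ [C ->] /ltW ?] := lb_ereal_inf_adherent e0 fin; exists C.
rewrite ge0_fin_numE ?value_ge0 // -leNgt leye_eq => /eqP ->.
have [u0] := input_nonempty S.
by exists (stop_controller p u0); rewrite addye // leey.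
Qed.

Lemma value_le_terminal_cost p : value Pi p <= terminal_cost Pi p.
Proof.
have [u0] := input_nonempty S.
apply: le_trans (ereal_inf_lbound _) _; first by exists (stop_controller p u0).
apply: ge_nnsup => [|_ [[[u v] x] Hb <-]]; first exact: terminal_cost_ge0.
have [v0 <-] := stop_behavior _ _ _ _ _ _ _ Hb.
by rewrite (cost_stop _ _ _ _ 0%N) // big_nil adde0.
Qed.

(** Apply [a] and then, from the successor [q], a controller within [e] of the
    value at [q]. *)
Lemma value_le_input p (a : U) :
  value Pi p <= nnsup [set running_cost Pi p q a + value Pi q
                             | q in transition S (p, a)].
Proof.
apply/lee_addgt0Pr => e e0.
have [C HC] := choice (fun q => near_optimal_controller q e e0).
apply: le_trans (ereal_inf_lbound _) _.
  by exists (delayed_controller p a C).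
apply: ge_nnsup.
  by rewrite adde_ge0 ?nnsup_ge0 // lee_fin ltW.
move=> _ [[[u v] x] Hb <-].
have [u0 v0 x0 Fx1 Hq] := delayed_behavior _ _ _ _ _ _ _ _ Hb.
rewrite cost_shift // x0 u0.
apply: le_trans (leeD2l _ _) _.
  apply: le_trans (HC (x 1%N)); apply: nnsup_ubound.
  by exists (fun t => u t.+1, fun t => v t.+1, fun t => x t.+1).
by rewrite addeA leeD2r //; apply: nnsup_ubound; exists (x 1%N).
Qed.

Lemma value_le_dp_operator p :
  value Pi p <= dp_operator Pi (value Pi) p.
Proof.
rewrite /dp_operator le_min value_le_terminal_cost /=.
by apply: le_ereal_inf_tmp => _ [a _ <-]; exact: value_le_input.
Qed.

End DynamicProgramming.

Theorem mainTheorem1 (R : realType) (X U : Type) (Pi : control_problem R X U) :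
  [/\ forall p : X, 0 <= value Pi p,
      dp_operator Pi (value Pi) = value Pi,
      forall W : X -> \bar R,
        (forall p, 0 <= W p) ->
        (forall p, W p <= dp_operator Pi W p) ->
        forall p, W p <= value Pi p &
      forall p : X,
        value Pi p =
        nnsup (image (causal_responses (plant Pi) p)
          (fun beta : (nat -> U) -> (nat -> X) =>
          ereal_inf (range (fun u : nat -> U =>
            ereal_inf (range (fun v : nat -> bool =>
              cost Pi (u, v, beta u)))))))].
Proof.
have maximal W : (forall p, 0 <= W p) ->
    (forall p, W p <= dp_operator Pi W p) -> forall p, W p <= value Pi p.
  move=> W0 WP p.
  apply: le_trans (causal_value_le_value Pi p).
  exact: subsolution_le_causal_value.
split=> //.
- exact: value_ge0.
- apply/funext => p; apply/eqP; rewrite eq_le value_le_dp_operator andbT.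
  apply: maximal => [q|q]; first exact: dp_operator_ge0.
  by apply: dp_operator_homo => r; exact: value_le_dp_operator.
- move=> p; apply/eqP; rewrite eq_le; apply/andP; split.
    apply: subsolution_le_causal_value; first exact: value_ge0.
    exact: value_le_dp_operator.
  exact: causal_value_le_value.
Qed.
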